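(* Let $\Theta\subseteq\mathbb{R}^d$ index a model $\{P_\theta:\theta\in\Theta\}$ and let $\Theta_\epsilon\subseteq\Theta$ be an $\epsilon$-discretization of $\Theta$, $\epsilon>0$. Assume $X^n=(X_1,\dots,X_n)$ has iid components with distribution $P$, and let $\hat\theta$ be the penalized MLE over $\Theta_\epsilon$ (iid modeling) with penalty $\mathcal{L}(\theta)=\|\theta\|^2$. Assume that for some $\theta^*,\tilde\theta^*\in\Theta$, some radius $R$ and some $a,b,c>0$, the Hellinger affinity satisfies $A(P,P_\theta)\le a/\|\theta-\theta^*\|^b$ for $\theta$ outside the ball $B(\theta^*,R)$ and $A(P,P_\theta)\le e^{-c\|\theta-\tilde\theta^*\|^2}$ for $\theta$ inside the ball $B(\theta^*,R)$. If $R\ge\max(11a^{1/b},3\epsilon)$, then $$\mathbb{E}\,D_B(P,P_{\hat\theta})\le 2\mathcal{R}^{(n)}_{\Theta_\epsilon,\|\cdot\|^2}(P)+\frac{4d\left[\log\left(1+\frac{2\sqrt{2\pi}}{\epsilon\sqrt{nc}}\right)+\log\left(1+\frac{29\sqrt d+6R}{\epsilon\sqrt{nb}}\right)\right]}{n}+\frac{4\log\left(2+2\cdot\frac{22}{R^3}\right)+2\|\theta^*\|^2+8}{n}.$$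
   Context: Lower-case letters denote densities: $p$ and $p_\theta$ are the densities of $P$ and $P_\theta$ with respect to a common dominating measure (Lebesgue or counting measure). The Hellinger affinity is $A(P,Q)=\int\sqrt{p(x)q(x)}\,dx$, the Bhattacharyya divergence is $D_B(P,Q)=2\log\frac{1}{A(P,Q)}$, and $D(P\|Q)$ is relative entropy; all are for a single observation. An $\epsilon$-discretization of $\Theta\subseteq\mathbb{R}^d$ is a set of the form $\Theta\cap(v+\epsilon\mathbb{Z}^d)$ for some $v\in\mathbb{R}^d$. The penalized MLE $\hat\theta=\hat\theta(X^n)$ is a parameter maximizing $\sum_{i=1}^n\log p_\theta(X_i)-\mathcal{L}(\theta)$ over $\theta\in\Theta_\epsilon$; a maximizer is assumed to exist for every possible data value (ties broken arbitrarily). $\mathcal{R}^{(n)}_{\Theta_\epsilon,\|\cdot\|^2}(P)=\inf_{\theta\in\Theta_\epsilon}\{D(P\|P_\theta)+\|\theta\|^2/n\}$. $B(\theta^*,R)$ is the closed Euclidean ball. Expectations are over $X^n\sim P^n$. *)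

(* Defs.v *)
From HB Require Import structures.
From mathcomp Require Import all_boot all_order all_algebra.
From mathcomp Require Import all_classical all_reals all_analysis.

Set Implicit Arguments.
Unset Strict Implicit.
Unset Printing Implicit Defensive.

Import Order.TTheory GRing.Theory Num.Theory.
Import numFieldNormedType.Exports.

Local Open Scope classical_set_scope.
Local Open Scope ring_scope.

Section EuclideanSpace.
Context {R : realType} {d : nat}.
Implicit Types (x v : 'rV[R]_d) (Theta : set 'rV[R]_d).

(* The library's norm on matrices is the sup norm. *)
Definition enorm x : R := Num.sqrt (\sum_(i < d) x ord0 i ^+ 2).

Definition closed_eball x (r : R) : set 'rV[R]_d :=
  [set y | enorm (y - x) <= r].

Definition shifted_lattice v (eps : R) : set 'rV[R]_d :=
  [set v + eps *: map_mx intr z | z in [set: 'rV[int]_d]].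

Definition is_discretization (eps : R) Theta (Theta_eps : set 'rV[R]_d) :=
  exists v, Theta_eps = Theta `&` shifted_lattice v eps.

End EuclideanSpace.

Section Densities.
Context {dT : measure_display} {T : measurableType dT} {R : realType}.
Variable mu : {measure set T -> \bar R}.
Implicit Types p q : T -> R.

Definition is_density (P : probability T R) p :=
  [/\ measurable_fun [set: T] p,
      (forall x, 0 <= p x) &
      forall A, measurable A -> P A = (\int[mu]_(x in A) (p x)%:E)%E].

Local Open Scope ereal_scope.

Definition affinity p q : \bar R :=
  \int[mu]_x (Num.sqrt (p x * q x)%R)%:E.

(* Equals +oo when the affinity is 0, since 0^-1 = +oo in \bar R. *)
Definition bhattacharyya p q : \bar R := 2%:E * lne (affinity p q)^-1.

(* The conventions of \bar R (0 * y = 0, 0^-1 = +oo, lne 0 = -oo) give the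
   integrand the value 0 where p vanishes and +oo where only q vanishes. *)
Definition relative_entropy p q : \bar R :=
  \int[mu]_x ((p x)%:E * lne ((p x)%:E / (q x)%:E)).

End Densities.

Section PenalizedLikelihood.
Context {dT : measure_display} {T : measurableType dT} {R : realType}.
Context {d n : nat}.
Variable q : 'rV[R]_d -> T -> R.
Implicit Types (theta : 'rV[R]_d) (pen : 'rV[R]_d -> R).
Implicit Types (Theta : set 'rV[R]_d).

Local Open Scope ereal_scope.

(* Takes the value -oo when some observation has zero likelihood. *)
Definition penalized_loglik pen (x : 'I_n -> T) theta : \bar R :=
  \sum_(i < n) lne (q theta (x i))%:E - (pen theta)%:E.

(* Ties may be broken in any way, not necessarily measurably. *)
Definition is_penalized_mle pen Theta (est : ('I_n -> T) -> 'rV[R]_d) :=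
  forall x, Theta (est x) /\
    forall theta, Theta theta ->
      penalized_loglik pen x theta <= penalized_loglik pen x (est x).

Definition resolvability (m : nat) (mu : {measure set T -> \bar R})
    (p : T -> R) pen Theta : \bar R :=
  ereal_inf [set relative_entropy mu p (q theta) + (pen theta / m%:R)%:E
            | theta in Theta].

End PenalizedLikelihood.

Section IID.
Context {dO dT : measure_display} {Omega : measurableType dO}.
Context {T : measurableType dT} {R : realType} {Pr : probability Omega R}.
Context {n : nat}.

Definition mutually_independent (X : 'I_n -> {RV Pr >-> T}) :=
  forall (J : {set 'I_n}) (A : 'I_n -> set T),
    (forall i, measurable (A i)) ->
    Pr (\bigcap_(i in [set` J]) (X i @^-1` A i)) =
    (\prod_(i in J) Pr (X i @^-1` A i))%E.

Definition iid_sample (P : probability T R) (X : 'I_n -> {RV Pr >-> T}) :=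
  mutually_independent X /\
  forall i A, measurable A -> distribution Pr (X i) A = P A.

End IID.

(* Main.v *)
Require Import Defs.
From HB Require Import structures.
From mathcomp Require Import all_boot all_order all_algebra.
From mathcomp Require Import all_classical all_reals all_analysis.
From mathcomp Require Import measurable_realfun.
From mathcomp Require Import ring lra zify.

Set Implicit Arguments.
Unset Strict Implicit.
Unset Printing Implicit Defensive.

Import Order.TTheory GRing.Theory Num.Theory.
Import numFieldNormedType.Exports.

Local Open Scope classical_set_scope.
Local Open Scope ring_scope.

(** The proof is an exponential-moment argument followed by a lattice sum.

    For a parameter [theta] with penalty [L] and affinity [A], call
    [e^(-L/2) A^(-n/2) prod_i sqrt (p_theta (X_i) / p (X_i))] its score.
    Each factor under the product has mean [A], so by independence the score
    has mean [e^(-L/2) A^(n/2)].  Let [S] be the sum of the scores over the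
    discretized parameter set and let [C] bound the sum of their means.  The
    score of the penalized MLE is at most [S] whatever the data.  Taking logarithms, using
    [ln S <= ln C + S / C - 1], and replacing the penalized log-likelihood of
    the MLE by the smaller one of an arbitrary competitor [theta], one gets the
    pointwise inequality
    [n D_B (P, P_hat) <= 2 sum_i ln (p / p_theta) (X_i) + 2 L (theta)
       + 4 ln C + 4 (S / C - 1)]
    ([bhattacharyya_le_score]).  Its expectation is
    [E D_B <= 2 (D (P || P_theta) + L (theta) / n) + 4 ln C / n]
    ([penalized_mle_risk_le]), and the infimum over [theta] gives the
    resolvability.  The factor 2 in front of the resolvability is what pays for
    the extra factor [A^(n/2)] in the mean of the score: without it the lattice
    sum would have to be controlled by the penalty alone.

    It remains to find [C] for the penalty [|theta|^2].  Inside the ball the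
    affinity hypothesis makes the mean score at most a Gaussian centred at
    [theta_t]; outside the ball it makes [A^(n/2)] at most [e^(-n b / 2)], and
    [|theta - theta_s|^2 <= 2 |theta|^2 + 2 |theta_s|^2] turns the penalty into
    a Gaussian centred at [theta_s] at the price of [e^(|theta_s|^2 / 2)]
    ([weight_le_envelope]).  A Gaussian sum over a lattice factorizes over the
    coordinates, and [e^(-x^2) <= 1 / (1 + x^2)] with primitive [atan] bounds
    each one-dimensional sum by [1 + pi / h] for step [h]
    ([sum_lattice_gaussian_le]).  For the outer Gaussian the factor
    [e^(-n b / 2)] is spread over the [d] coordinates to produce the
    [sqrt (n b)] in the denominator ([gaussian_factor_out_le]). *)

(** * Integrals against densities, and independence *)

Section MonotoneIntegral.
Context {dT : measure_display} {T : measurableType dT} {R : realType}.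
Variable mu : {measure set T -> \bar R}.
Local Open Scope ereal_scope.
Import HBNNSimple.

(** For nonnegative functions the integral is a supremum over the simple
    functions below, hence monotone even for non-measurable integrands.  This
    is what allows an estimator that breaks ties non-measurably. *)
Lemma ge0_le_lower_integral (f g : T -> \bar R) :
  (forall x, 0 <= f x) -> (forall x, f x <= g x) ->
  \int[mu]_x f x <= \int[mu]_x g x.
Proof.
move=> f0 fg.
have g0 x : 0 <= g x by apply: le_trans (f0 x) (fg x).
rewrite !ge0_integralTE//; apply: ereal_sup_le => _ [h hf <-].
by exists h => // x; apply: le_trans (hf x) (fg x).
Qed.

End MonotoneIntegral.

Section WeightedIntegral.
Local Open Scope ereal_scope.
Import HBNNSimple.

Section Approximation.
Context {dO dT : measure_display} {Omega : measurableType dO}.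
Context {T : measurableType dT} {R : realType}.
Variables (m : {measure set Omega -> \bar R}) (X : Omega -> T) (Y : Omega -> R).
Hypotheses (mX : measurable_fun setT X) (mY : measurable_fun setT Y).
Hypothesis Y_ge0 : forall w, (0 <= Y w)%R.

(** The right-hand side depends on [m], [X] and [Y] only through the set
    function sending [A] to the integral of [Y] over the preimage of [A]. *)
Lemma ge0_integral_weighted_lim (f : T -> \bar R)
    (mf : measurable_fun [set: T] f) (h := nnsfun_approx measurableT mf) :
  (forall x, 0 <= f x) ->
  \int[m]_w (f (X w) * (Y w)%:E) =
  limn (fun n => \sum_(r \in range (h n))
    r%:E * \int[m]_w (\1_(h n @^-1` [set r]) (X w) * Y w)%:E).
Proof.
move=> f_ge0.
pose g n w := (h n (X w) * Y w)%:E.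
have mg n : measurable_fun setT (g n).
  apply/measurable_EFinP; apply: measurable_funM => //.
  by apply: measurableT_comp => //.
have -> : \int[m]_w (f (X w) * (Y w)%:E) = \int[m]_w limn (g^~ w).
  apply: eq_integral => w _; apply/esym/cvg_lim => //.
  rewrite /g; under eq_fun do rewrite EFinM.
  apply: cvgeZr => //; exact: cvg_nnsfun_approx.
rewrite monotone_convergence//; last 2 first.
- by move=> n w _; rewrite lee_fin mulr_ge0.
- move=> w _ a b ab; rewrite lee_fin ler_wpM2r//.
  exact/lefP/nd_nnsfun_approx.
congr (limn _); apply/funext => n.
transitivity (\int[m]_w (\sum_(r \in range (h n))
    (r * (\1_(h n @^-1` [set r]) (X w) * Y w))%:E)).
  apply: eq_integral => w _.
  rewrite fsumEFin// /g (fimfunE (h n)) mulrC; congr EFin.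
  rewrite mulr_fsumr; apply: eq_fsbigr => r _.
  by rewrite mulrCA [(Y w * _)%R]mulrC.
have mone r : measurable_fun setT
    (fun w => (\1_(h n @^-1` [set r]) (X w) * Y w)%:E).
  apply/measurable_EFinP; apply: measurable_funM => //.
  by apply: measurableT_comp => //.
rewrite ge0_integral_fsum//; last 2 first.
- move=> r; under eq_fun do rewrite EFinM.
  exact: measurable_funeM.
- move=> r w _; rewrite lee_fin mulrA mulr_ge0//.
  have := nnfun_muleindic_ge0 (h n) r (X w).
  by rewrite lee_fin.
apply: eq_fsbigr => r; rewrite inE => -[t _ <-].
under eq_integral do rewrite EFinM.
rewrite ge0_integralZl_EFin//.
by move=> w _; rewrite lee_fin mulr_ge0.
Qed.

End Approximation.

(** Two weighted images that agree on indicators agree on all nonnegative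
    functions.  Used both for changing a density into a measure and for
    extending independence from events to functions. *)
Lemma ge0_integral_weighted_transfer (R : realType)
    (d1 d2 dT : measure_display) (O1 : measurableType d1)
    (O2 : measurableType d2) (T : measurableType dT)
    (m1 : {measure set O1 -> \bar R}) (m2 : {measure set O2 -> \bar R})
    (X1 : O1 -> T) (X2 : O2 -> T) (Y1 : O1 -> R) (Y2 : O2 -> R) :
  measurable_fun setT X1 -> measurable_fun setT X2 ->
  measurable_fun setT Y1 -> measurable_fun setT Y2 ->
  (forall w, (0 <= Y1 w)%R) -> (forall w, (0 <= Y2 w)%R) ->
  (forall A, measurable A ->
    \int[m1]_w (\1_A (X1 w) * Y1 w)%:E = \int[m2]_w (\1_A (X2 w) * Y2 w)%:E) ->
  forall f : T -> \bar R, measurable_fun [set: T] f -> (forall x, 0 <= f x) ->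
    \int[m1]_w (f (X1 w) * (Y1 w)%:E) = \int[m2]_w (f (X2 w) * (Y2 w)%:E).
Proof.
move=> mX1 mX2 mY1 mY2 Y1_ge0 Y2_ge0 eq12 f mf f_ge0.
rewrite (ge0_integral_weighted_lim _ mX1 mY1 Y1_ge0 mf)//.
rewrite (ge0_integral_weighted_lim _ mX2 mY2 Y2_ge0 mf)//.
congr (limn _); apply/funext => n; apply: eq_fsbigr => r _.
by rewrite eq12.
Qed.

(** On indicators this is the definition of a density. *)
Lemma ge0_integral_density (R : realType) (dT : measure_display)
    (T : measurableType dT) (mu : {measure set T -> \bar R})
    (P : probability T R) (p : T -> R) : is_density mu P p ->
  forall f : T -> \bar R, measurable_fun [set: T] f -> (forall x, 0 <= f x) ->
    \int[P]_x f x = \int[mu]_x (f x * (p x)%:E).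
Proof.
move=> [mp p_ge0 pP] f mf f_ge0.
transitivity (\int[P]_x (f (id x) * (cst 1%R x)%:E)).
  by apply: eq_integral => x _ /=; rewrite mule1.
apply: (@ge0_integral_weighted_transfer _ _ _ _ _ _ _
  P mu id id (cst 1%R) p) => //.
move=> A mA.
transitivity (P A).
  under eq_integral do rewrite mulr1.
  by rewrite integral_indic// setIT.
rewrite pP// integral_mkcond.
apply: eq_integral => x _; rewrite epatch_indic.
by rewrite EFinM muleC.
Qed.

End WeightedIntegral.

(** Independence is the case of indicators.  The factors are generalized from
    indicators to functions one index at a time: with all factors but one held
    fixed, both sides are weighted integrals of the remaining one. *)
Lemma indep_expectation_prod (R : realType) (dO dT : measure_display)
    (Omega : measurableType dO) (T : measurableType dT)
    (Pr : probability Omega R) (n : nat) (X : 'I_n -> {RV Pr >-> T}) :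
  mutually_independent X ->
  forall f : 'I_n -> T -> R,
    (forall i, measurable_fun setT (f i)) -> (forall i x, 0 <= f i x) ->
    (forall i, (\int[Pr]_w (f i (X i w))%:E < +oo)%E) ->
    (\int[Pr]_w (\prod_i f i (X i w))%:E =
     \prod_i \int[Pr]_w (f i (X i w))%:E)%E.
Proof.
move=> indX f mf f_ge0 f_fin.
have mX i : measurable_fun setT (X i) by [].
have mXA i A : measurable A -> measurable (X i @^-1` A).
  by move=> mA; rewrite -[X in measurable X]setTI; exact: mX.
have intXA i A : measurable A ->
    (\int[Pr]_w (\1_A (X i w))%:E = Pr (X i @^-1` A))%E.
  move=> mA; rewrite -[LHS]/(\int[Pr]_w (\1_(X i @^-1` A) w)%:E)%E.
  by rewrite integral_indic// ?setIT//; exact: mXA.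
(* Only the factors of index below [k] are allowed to be general. *)
suff H k : forall g : 'I_n -> T -> R,
    (forall i, measurable_fun setT (g i)) -> (forall i x, 0 <= g i x) ->
    (forall i, (\int[Pr]_w (g i (X i w))%:E < +oo)%E) ->
    (forall i : 'I_n, (k <= i)%N -> exists2 A, measurable A & g i = \1_A) ->
    (\int[Pr]_w (\prod_i g i (X i w))%:E =
     \prod_i \int[Pr]_w (g i (X i w))%:E)%E.
  by apply: (H n f) => // i; rewrite leqNgt ltn_ord.
elim: k => [|k IH] g mg g_ge0 g_fin gind.
  have /all_sig2[A mA gA] : forall i : 'I_n, {A | measurable A & g i = \1_A}.
    by move=> i; apply: cid2; apply: gind.
  have E1 w : \prod_i g i (X i w) =
      \1_(\bigcap_(i in [set` [set: 'I_n]%SET]) (X i @^-1` A i)) w.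
    rewrite indicE; case: (boolP (w \in _)) => [|/negP]; rewrite inE.
      move=> H; rewrite big1// => i _; rewrite gA indicE mem_set//.
      by apply: H => /=; rewrite inE.
    move=> H /=; have [i Hi] : exists i, ~ A i (X i w).
      by apply/existsNP => H'; apply: H => i _; exact: H'.
    by rewrite (bigD1 i)//= gA indicE memNset// mul0r.
  under eq_integral do rewrite E1.
  rewrite integral_indic// ?setIT; last first.
    by apply: fin_bigcap_measurable => // i _; exact: mXA.
  apply: etrans (indX [set: 'I_n]%SET A mA) _.
  rewrite [LHS](eq_bigl predT); last by move=> i; rewrite inE.
  by apply: eq_bigr => i _; rewrite gA intXA.
have [nk|kn] := leqP n k.
  by apply: IH => // i ki; have := ltn_ord i; rewrite ltnNge (leq_trans nk ki).
pose j := Ordinal kn.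
pose K := (\prod_(i | i != j) \int[Pr]_w (g i (X i w))%:E)%E.
have K_fin : K \is a fin_num.
  apply: prode_fin_num => i _; rewrite ge0_fin_numE//.
  by apply: integral_ge0 => w _; rewrite lee_fin.
have K_ge0 : (0 <= K)%E.
  by apply: prode_ge0 => i _; apply: integral_ge0 => w _; rewrite lee_fin.
pose Y w := \prod_(i | i != j) g i (X i w).
have mY : measurable_fun setT Y.
  rewrite /Y; under eq_fun do rewrite big_mkcond.
  apply: measurable_prod => i _; case: (i != j) => //.
  by apply: measurableT_comp.
have Y_ge0 w : 0 <= Y w by apply: prodr_ge0.
transitivity (\int[Pr]_w ((g j (X j w))%:E * (Y w)%:E))%E.
  by apply: eq_integral => w _; rewrite (bigD1 j)// EFinM.
have H A : measurable A ->
    (\int[Pr]_w (\1_A (X j w) * Y w)%:E =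
     \int[Pr]_w (\1_A (X j w) * cst (fine K) w)%:E)%E.
  move=> mA.
  pose g' i := if i == j then \1_A else g i.
  have mg' i : measurable_fun setT (g' i) by rewrite /g'; case: ifP.
  have g'_ge0 i x : 0 <= g' i x by rewrite /g'; case: ifP.
  have EA : (\int[Pr]_w (g' j (X j w))%:E = Pr (X j @^-1` A))%E.
    by rewrite /g' eqxx; exact: intXA.
  have E2 i : i != j -> g' i = g i by move=> /negbTE ij; rewrite /g' ij.
  transitivity (\int[Pr]_w (\prod_i g' i (X i w))%:E)%E.
    apply: eq_integral => w _; rewrite (bigD1 j)//=; congr (_ * _)%:E.
      by rewrite /g' eqxx.
    by apply: eq_bigr => i /E2 ->.
  rewrite IH//; last 2 first.
  + move=> i; have [->|/E2->//] := eqVneq i j.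
    rewrite EA; apply: le_lt_trans (probability_le1 _ _) _.
      exact: mXA.
    by rewrite ltry.
  + move=> i; rewrite leq_eqVlt => /orP[/eqP ik|ki].
      by exists A => //; rewrite /g' (_ : i = j) ?eqxx//; exact: val_inj.
    have [A' mA' E] := gind i ki; exists A' => //.
    by rewrite E2//; apply: contraTneq ki => ->; rewrite ltnn.
  rewrite (bigD1 j)//=; under [RHS]eq_integral do rewrite EFinM.
  rewrite ge0_integralZr//; last 2 first.
  + by apply/measurable_EFinP; apply: measurableT_comp.
  + by rewrite lee_fin fine_ge0.
  congr (_ * _)%E; first by rewrite /g' eqxx.
  by rewrite fineK// /K; apply: eq_bigr => i /E2 ->.
rewrite (ge0_integral_weighted_transfer (mX j) (mX j) mY _ Y_ge0 _ H
  (f := fun x => (g j x)%:E))//; last 3 first.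
- by move=> w; rewrite fine_ge0.
- exact/measurable_EFinP.
- by move=> x; rewrite lee_fin.
rewrite /= ge0_integralZr//; last 3 first.
+ by apply/measurable_EFinP; apply: measurableT_comp.
+ by move=> w _; rewrite lee_fin.
+ by rewrite lee_fin fine_ge0.
by rewrite [RHS](bigD1 j)//= fineK.
Qed.

(** * Gaussian sums over a shifted lattice *)

Section LatticeSums.
Context {R : realType}.
Implicit Types (h t x : R).

(** Majorant of the Gaussian with an elementary primitive, [atan]. *)
Definition lorentz x : R := (1 + x ^+ 2)^-1.

Lemma lorentz_gt0 x : 0 < lorentz x.
Proof. by rewrite invr_gt0 ltr_wpDr// sqr_ge0. Qed.

Lemma lorentz_le1 x : lorentz x <= 1.
Proof. by rewrite invf_le1 ?ltr_wpDr ?sqr_ge0// lerDl sqr_ge0. Qed.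

Lemma lorentzN x : lorentz (- x) = lorentz x.
Proof. by rewrite /lorentz sqrrN. Qed.

Lemma expRN_sqr_le_lorentz x : expR (- x ^+ 2) <= lorentz x.
Proof.
rewrite expRN lef_pV2 ?posrE ?expR_gt0 ?ltr_wpDr ?sqr_ge0//.
exact: expR_ge1Dx.
Qed.

(** Comparison of a term with the integral over the step on its left; the
    midpoint condition [h / 2 <= x] ensures that [x] is the point of that step
    farthest from 0. *)
Lemma lorentz_le_atan h x : 0 < h -> h / 2 <= x ->
  h * lorentz x <= atan x - atan (x - h).
Proof.
move=> h0 hx.
have lt_x : x - h < x by rewrite ltrBlDr ltrDl.
have datan z : z \in `]x - h, x[ -> is_derive z 1 atan (1 + z ^+ 2)^-1.
  by move=> _; exact: is_derive1_atan.
have catan : {within `[x - h, x], continuous (@atan R)}.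
  by apply: derivable_within_continuous => z _; exact: ex_derive.
have [c /[!in_itv]/= /andP[c1 c2] ->] := MVT lt_x datan catan.
rewrite subKr mulrC ler_wpM2r ?(ltW h0)//.
rewrite lef_pV2 ?posrE ?ltr_wpDr ?sqr_ge0// lerD2l.
have : 0 <= (x - c) * (x + c) by apply: mulr_ge0; lra.
by rewrite -subr_sqr subr_ge0.
Qed.

Lemma sum_lorentz_right h t m : 0 < h -> - (h / 2) <= t ->
  h * \sum_(i < m) lorentz (t + h * i.+1%:R) <= atan (t + h * m%:R) - atan t.
Proof.
move=> h0 ht; elim: m => [|m IH]; first by rewrite big_ord0 !mulr0 addr0 subrr.
rewrite big_ord_recr/= mulrDr.
have := @lorentz_le_atan h (t + h * m.+1%:R) h0.
have -> : t + h * m.+1%:R - h = t + h * m%:R by rewrite -(natr1 m); ring.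
have : 0 <= h * m%:R by rewrite mulr_ge0// ltW.
rewrite -(natr1 m) mulrDr mulr1 => hm /(_ _) H.
have {}H := H ltac:(lra).
by lra.
Qed.

(** A sum of unimodal terms is at most one term plus an integral.  The first
    node [>= - (h / 2)] contributes the isolated [h]; an earlier node is charged
    to the step on its right, a later one to the step on its left. *)
Lemma sum_lorentz_atan h t m : 0 < h ->
  h * \sum_(i < m) lorentz (t + h * i%:R) <= h + (atan (t + h * m%:R) - atan t).
Proof.
move=> h0; elim: m t => [|m IH] t.
  by rewrite big_ord0 !mulr0 addr0 subrr addr0 ltW.
rewrite big_ord_recl/= mulr0 addr0 mulrDr.
have [ht|ht] := leP (- (h / 2)) t.
  have H1 := sum_lorentz_right m h0 ht.
  have H2 : h * lorentz t <= h by rewrite ler_piMr ?lorentz_le1// ltW.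
  have H3 : atan (t + h * m%:R) <= atan (t + h * m.+1%:R).
    by apply: le_atan; rewrite lerD2l ler_pM2l// ler_nat.
  by rewrite /bump/=; under eq_bigr do rewrite add1n; lra.
have H1 : h * lorentz t <= atan (t + h) - atan t.
  rewrite -lorentzN; have := @lorentz_le_atan h (- t) h0.
  rewrite -opprD !atanN opprK => H.
  by have {}H := H ltac:(lra); lra.
have := IH (t + h).
have -> : t + h + h * m%:R = t + h * m.+1%:R by rewrite -(natr1 m); ring.
have -> : \sum_(i < m) lorentz (t + h * (bump 0 i)%:R) =
    \sum_(i < m) lorentz (t + h + h * i%:R).
  by apply: eq_bigr => i _; rewrite /bump/= add1n -natr1; congr lorentz; ring.
by lra.
Qed.

Lemma sum_lorentz_le h t m : 0 < h ->
  \sum_(i < m) lorentz (t + h * i%:R) <= 1 + pi / h.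
Proof.
move=> h0; rewrite -(ler_pM2l h0) mulrDr mulr1 mulrCA divff ?gt_eqF// mulr1.
have := sum_lorentz_atan t m h0.
have := atan_ltpi2 (t + h * m%:R); have := atan_gtNpi2 t.
by lra.
Qed.

Lemma ler_sum_uniq_subset (I : eqType) (F : I -> R) (s1 s2 : seq I) :
  uniq s1 -> uniq s2 -> {subset s1 <= s2} -> (forall i, 0 <= F i) ->
  \sum_(i <- s1) F i <= \sum_(i <- s2) F i.
Proof.
move=> u1 u2 s12 F0.
have P : perm_eq s1 [seq i <- s2 | i \in s1].
  apply: uniq_perm => //; first exact: filter_uniq.
  by move=> i; rewrite mem_filter; case: (boolP (i \in s1)) => // /s12 ->.
rewrite (perm_big _ P)/= big_filter big_mkcond/=.
by apply: ler_sum => i _; case: ifP.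
Qed.

(** A finite set of lattice points lies in a box, where the sum of products is
    a product of sums. *)
Lemma sum_lattice_lorentz_le (d : nat) h (t : 'I_d -> R) (s : seq 'rV[int]_d) :
  0 < h -> uniq s ->
  \sum_(z <- s) \prod_(i < d) lorentz (t i + h * (z ord0 i)%:~R)
    <= (1 + pi / h) ^+ d.
Proof.
move=> h0 us.
pose N := (\max_(z <- s) \max_(i < d) `|z ord0 i|)%N.
have zN z i : z \in s -> (`|z ord0 i| <= N)%N.
  move=> zs; apply: leq_trans (leq_bigmax_seq _ zs _); last by [].
  exact: leq_bigmax.
pose M := (N + N).+1.
pose g (f : {ffun 'I_d -> 'I_M}) : 'rV[int]_d := \row_i ((f i : nat)%:Z - N%:Z).
have g_inj : injective g.
  move=> f1 f2 /rowP E; apply/ffunP => i; have := E i; rewrite !mxE.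
  by move=> /addIr/eqP; rewrite eqz_nat => /eqP/val_inj.
have sg z : z \in s -> exists f, z = g f.
  move=> zs; exists [ffun i => inord (absz (z ord0 i + N%:Z)%R)].
  apply/rowP => i; rewrite mxE ffunE.
  have : (`|z ord0 i| <= N)%N := zN z i zs.
  move: (z ord0 i : int) => k Hk.
  have Hk0 : 0 <= k + N%:Z by clear -Hk; lia.
  rewrite inordK; first by rewrite gez0_abs// addrK.
  by rewrite /M; clear -Hk; lia.
apply: (@le_trans _ _ (\sum_(z <- [seq g f | f : {ffun 'I_d -> 'I_M}])
    \prod_(i < d) lorentz (t i + h * (z ord0 i)%:~R))).
  apply: ler_sum_uniq_subset => //.
  - by rewrite map_inj_uniq// enum_uniq.
  - by move=> z /sg[f ->]; apply: map_f; rewrite mem_enum.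
  - by move=> z; apply: prodr_ge0 => i _; exact/ltW/lorentz_gt0.
rewrite big_image/=.
under eq_bigr do under eq_bigr do rewrite mxE.
rewrite -(bigA_distr_bigA (fun i (j : 'I_M) =>
  lorentz (t i + h * ((j : nat)%:Z - N%:Z)%:~R))).
have -> : (1 + pi / h) ^+ d = \prod_(i < d) (1 + pi / h).
  by rewrite prodr_const card_ord.
apply: ler_prod => i _; apply/andP; split.
  by apply: sumr_ge0 => j _; exact/ltW/lorentz_gt0.
apply: le_trans (sum_lorentz_le (t i - h * N%:R) M h0).
apply: ler_sum => j _; rewrite intrB -!pmulrn.
by rewrite (_ : _ + _ = t i - h * N%:R + h * j%:R)//; ring.
Qed.

Lemma sum_lattice_gaussian_le (d : nat) (al eps : R) (v u : 'rV[R]_d)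
    (s : seq 'rV[int]_d) : 0 < al -> 0 < eps -> uniq s ->
  \sum_(z <- s) expR (- (al * enorm (v + eps *: map_mx intr z - u) ^+ 2))
    <= (1 + pi / (eps * Num.sqrt al)) ^+ d.
Proof.
move=> al0 eps0 us.
have sal0 : 0 < Num.sqrt al by rewrite sqrtr_gt0.
apply: le_trans (@sum_lattice_lorentz_le d _
  (fun i => Num.sqrt al * (v ord0 i - u ord0 i)) s (mulr_gt0 eps0 sal0) us).
apply: ler_sum => z _.
rewrite sqr_sqrtr ?sumr_ge0//; last by move=> i _; exact: sqr_ge0.
rewrite mulr_sumr -sumrN expR_sum; apply: ler_prod => i _.
rewrite expR_ge0/=; apply: le_trans (expRN_sqr_le_lorentz _).
rewrite ler_expR lerN2 !mxE le_eqVlt; apply/orP; left; apply/eqP.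
rewrite -[al in RHS]sqr_sqrtr ?(ltW al0)//; ring.
Qed.

End LatticeSums.

(** * Numerical constants and the two Gaussian envelopes *)

Section Constants.
Context {R : realType}.

Lemma pi_lt4 : pi < 4 :> R.
Proof. by have := pihalf_lt2 R; lra. Qed.

Lemma expR1_le11 : expR 1 <= 11 :> R.
Proof.
have h : (2 : R)^-1 <= expR (- 2^-1) by apply: le_trans (expR_ge1Dx _); lra.
have : (2 : R)^-1 ^+ 2 <= expR (- 2^-1) ^+ 2.
  by rewrite ler_sqr ?nnegrE ?expR_ge0// ?invr_ge0.
rewrite -expRM_natl mulrN divff// expRN -[leLHS]invrK.
by rewrite lef_pV2 ?posrE ?expR_gt0//; lra.
Qed.

(** Amounts to [pi <= 2 * sqrt pi], that is [pi <= 4]. *)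
Lemma gaussian_factor_in_le (eps m c : R) : 0 < eps -> 0 < m -> 0 < c ->
  1 + pi / (eps * Num.sqrt (m * c / 2))
    <= 1 + 2 * Num.sqrt (2 * pi) / (eps * Num.sqrt (m * c)).
Proof.
move=> e0 m0 c0; rewrite lerD2l.
have mc0 : 0 < m * c by rewrite mulr_gt0.
have s1 : 0 < Num.sqrt (m * c) by rewrite sqrtr_gt0.
have s2 : 0 < Num.sqrt (m * c / 2) by rewrite sqrtr_gt0 divr_gt0.
have pi0 := pi_gt0 R.
rewrite ler_pdivrMr ?mulr_gt0// mulrAC ler_pdivlMr ?mulr_gt0//.
rewrite mulrCA [leRHS]mulrCA ler_pM2l//.
rewrite -[leRHS]mulrA -sqrtrM; last by rewrite mulr_ge0// ltW.
have -> : 2 * pi * (m * c / 2) = pi * (m * c) by field.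
rewrite (sqrtrM _ (ltW pi0)) mulrA ler_pM2r//.
have sp : 0 < Num.sqrt pi :> R by rewrite sqrtr_gt0.
rewrite -{1}(sqr_sqrtr (ltW pi0)) expr2 ler_pM2r//.
by rewrite -[leRHS]ger0_norm// -sqrtr_sqr ler_wsqrtr//; have := pi_lt4; lra.
Qed.

(** With [t = m * b / d] the exponential is the [d]-th power of
    [expR (- (t / 2))], so each coordinate takes one such factor.  It is at most
    1, and at most [1 / sqrt t], which turns [2 * pi / eps] into
    [2 * pi * sqrt d / (eps * sqrt (m * b))]. *)
Lemma gaussian_factor_out_le (eps m b r : R) (d : nat) :
  0 < eps -> 0 < m -> 0 < b -> 0 <= r ->
  expR (- (m * b / 2)) * (1 + pi / (eps * Num.sqrt (4^-1))) ^+ d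
    <= (1 + (29 * Num.sqrt d%:R + 6 * r) / (eps * Num.sqrt (m * b))) ^+ d.
Proof.
move=> e0 m0 b0 r0; have mb0 : 0 < m * b by rewrite mulr_gt0.
case: d => [|d].
  by rewrite !expr0 mulr1 expR_le1 oppr_le0 divr_ge0// ltW.
set D : R := d.+1%:R; have D0 : 0 < D by rewrite ltr0n.
pose t := m * b / D.
have t0 : 0 < t by rewrite divr_gt0.
have -> : expR (- (m * b / 2)) = expR (- (t / 2)) ^+ d.+1.
  by rewrite -expRM_natl; congr expR; rewrite /t -/D; field; rewrite gt_eqF.
rewrite -exprMn lerXn2r ?nnegrE//.
- by rewrite mulr_ge0 ?expR_ge0// addr_ge0// divr_ge0 ?pi_ge0// mulr_ge0// ltW.
- by rewrite addr_ge0// divr_ge0// ?addr_ge0 ?mulr_ge0 ?sqrtr_ge0// ltW.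
rewrite mulrDr mulr1 lerD//; first by rewrite expR_le1 oppr_le0 divr_ge0// ltW.
have -> : Num.sqrt 4^-1 = 2^-1 :> R.
  rewrite (_ : 4^-1 = 2^-1 ^+ 2); first by rewrite sqrtr_sqr ger0_norm.
  by field.
have s1 : 0 < Num.sqrt (m * b) by rewrite sqrtr_gt0.
rewrite ler_pdivlMr ?mulr_gt0//.
have -> : expR (- (t / 2)) * (pi / (eps * 2^-1)) * (eps * Num.sqrt (m * b)) =
    2 * pi * (expR (- (t / 2)) * Num.sqrt (m * b)).
  by field; rewrite gt_eqF.
have -> : Num.sqrt (m * b) = Num.sqrt t * Num.sqrt D.
  by rewrite -sqrtrM ?(ltW t0)// /t divfK// gt_eqF.
have h1 : expR (- (t / 2)) * Num.sqrt t <= 1.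
  rewrite expRN mulrC ler_pdivrMr ?expR_gt0// mul1r.
  apply: le_trans (expR_ge1Dx _).
  have := sqr_ge0 (Num.sqrt t - 1).
  by rewrite sqrrB sqr_sqrtr ?(ltW t0)// expr1n mulr1; lra.
have sD := sqrtr_ge0 D.
rewrite mulrA; apply: (@le_trans _ _ (8 * Num.sqrt D)); last by lra.
rewrite [leLHS](_ : _ =
  2 * pi * (expR (- (t / 2)) * Num.sqrt t) * Num.sqrt D); last by ring.
rewrite ler_wpM2r//; apply: (@le_trans _ _ (2 * pi * 1)).
  by rewrite ler_wpM2l// mulr_ge0// pi_ge0.
by have := pi_lt4; lra.
Qed.

End Constants.

Section WeightBound.
Context {R : realType} {d : nat}.
Implicit Types theta u : 'rV[R]_d.

Lemma sqr_enorm theta : enorm theta ^+ 2 = \sum_(i < d) theta ord0 i ^+ 2.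
Proof. by rewrite sqr_sqrtr// sumr_ge0// => i _; exact: sqr_ge0. Qed.

Lemma sqr_enormB_le theta u :
  enorm (theta - u) ^+ 2 <= 2 * enorm theta ^+ 2 + 2 * enorm u ^+ 2.
Proof.
rewrite !sqr_enorm !mulr_sumr -big_split/=; apply: ler_sum => i _.
rewrite !mxE; have := sqr_ge0 (theta ord0 i + u ord0 i).
by rewrite sqrrB sqrrD; lra.
Qed.

Lemma sqrt_expR (x : R) : Num.sqrt (expR x) = expR (x / 2).
Proof.
rewrite (_ : expR x = expR (x / 2) ^+ 2).
  by rewrite sqrtr_sqr ger0_norm ?expR_ge0.
by rewrite -expRM_natl; congr expR; field.
Qed.

Lemma sqrt_exprn_le_expR (al x : R) (n : nat) : al <= expR (- x) ->
  Num.sqrt al ^+ n <= expR (- (n%:R * x / 2)).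
Proof.
move=> h; have -> : - (n%:R * x / 2) = n%:R * (- x / 2) by ring.
rewrite expRM_natl; apply: lerXn2r; rewrite ?nnegrE ?sqrtr_ge0 ?expR_ge0//.
by rewrite -sqrt_expR ler_wsqrtr.
Qed.

(** Outside the ball [x ^ b >= 11 ^ b * a >= expR b * a]. *)
Lemma affinity_tail_le (a b r x : R) : 0 < a -> 0 < b ->
  11 * a `^ b^-1 <= r -> r < x -> a / x `^ b <= expR (- b).
Proof.
move=> a0 b0 ar rx.
have y0 : 0 < 11 * a `^ b^-1 by rewrite mulr_gt0// powR_gt0.
have x0 : 0 < x by apply: le_lt_trans rx; apply: le_trans ar; exact: ltW.
rewrite ler_pdivrMr ?powR_gt0// expRN mulrC ler_pdivlMr ?expR_gt0//.
apply: (@le_trans _ _ ((11 * a `^ b^-1) `^ b)); last first.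
  rewrite ge0_ler_powR ?nnegrE ?(ltW b0) ?(ltW y0) ?(ltW x0)//.
  by rewrite (le_trans ar)// ltW.
rewrite powRM// ?powR_ge0// -powRrM mulVf ?gt_eqF// powRr1 ?(ltW a0)//.
rewrite mulrC ler_wpM2r ?(ltW a0)//.
rewrite -[b in expR b]mul1r expRM.
by rewrite ge0_ler_powR ?nnegrE ?(ltW b0) ?expR_ge0 ?expR1_le11.
Qed.

Lemma penalty_shift_le theta u :
  expR (- (enorm theta ^+ 2 / 2))
    <= expR (enorm u ^+ 2 / 2) * expR (- (4^-1 * enorm (theta - u) ^+ 2)).
Proof. by rewrite -expRD ler_expR; have := sqr_enormB_le theta u; lra. Qed.

End WeightBound.

(** * Affinity, Bhattacharyya divergence and relative entropy *)

Section Densities.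
Context {dT : measure_display} {T : measurableType dT} {R : realType}.
Variable mu : {measure set T -> \bar R}.
Implicit Types (P Q : probability T R) (p q : T -> R).

Local Open Scope ereal_scope.

Lemma measurable_sqrt_mul p q : measurable_fun [set: T] p ->
  measurable_fun [set: T] q ->
  measurable_fun [set: T] (fun x => (Num.sqrt (p x * q x)%R)%:E).
Proof.
move=> mp mq; apply/measurable_EFinP.
apply: (measurableT_comp (f := @Num.sqrt R)); last exact: measurable_funM.
apply: continuous_measurable_fun; exact: sqrt_continuous.
Qed.

Lemma affinity_ge0 p q : 0 <= affinity mu p q.
Proof. by apply: integral_ge0 => x _; rewrite lee_fin sqrtr_ge0. Qed.

Lemma integral_density_setT P p : is_density mu P p -> \int[mu]_x (p x)%:E = 1.
Proof. by move=> [_ _ <-//]; rewrite probability_setT. Qed.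

(** By [sqrt (p q) <= (p + q) / 2] and integration of the two densities. *)
Lemma affinity_le1 P Q p q : is_density mu P p -> is_density mu Q q ->
  affinity mu p q <= 1.
Proof.
move=> dp dq; have [mp p0 _] := dp; have [mq q0 _] := dq.
apply: (@le_trans _ _ (\int[mu]_x (2^-1%:E * ((p x)%:E + (q x)%:E)))).
  apply: ge0_le_integral => //.
  - exact: measurable_sqrt_mul.
  - apply: measurable_funeM; apply: emeasurable_funD; exact/measurable_EFinP.
  - move=> x _; rewrite lee_fin.
    rewrite -[leRHS]ger0_norm ?mulr_ge0 ?addr_ge0// -sqrtr_sqr ler_wsqrtr//.
    by have := sqr_ge0 (p x - q x); rewrite sqrrB exprMn sqrrD; lra.
rewrite ge0_integralZl_EFin//; last 2 first.
- by move=> x _; rewrite adde_ge0 ?lee_fin.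
- by apply: emeasurable_funD; exact/measurable_EFinP.
rewrite ge0_integralD//; last 4 first.
- by move=> x _; rewrite lee_fin.
- exact/measurable_EFinP.
- by move=> x _; rewrite lee_fin.
- exact/measurable_EFinP.
rewrite (integral_density_setT dp) (integral_density_setT dq).
by rewrite -EFinD -EFinM lee_fin; lra.
Qed.

Lemma bhattacharyya_ge0 P Q p q : is_density mu P p -> is_density mu Q q ->
  0 <= bhattacharyya mu p q.
Proof.
move=> dp dq; apply: mule_ge0 => //; rewrite lne_ge0.
have := affinity_le1 dp dq; have := affinity_ge0 p q.
case: (affinity mu p q) => [r| |]//; rewrite !lee_fin inver => r0 r1.
case: eqP => [_|/eqP r0']; first by rewrite leey.
by rewrite lee_fin -[leLHS]invr1 lef_pV2 ?posrE// lt_def r0'.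
Qed.

(** The integrand of the relative entropy divided by [p].  The value [+oo]
    where [p] vanishes is harmless under the density [p], and it keeps the sum
    over a sample away from [-oo], so that the pointwise risk inequality holds
    without excluding a null set. *)
Definition log_ratio p q x : \bar R :=
  if p x == 0%R then +oo else if q x == 0%R then +oo
  else (ln (p x) - ln (q x))%:E.

(** The square root of [q / p], through [ln] and [expR] so that its
    measurability and the logarithm of a product are immediate. *)
Definition sqrt_ratio p q x : R :=
  if (p x == 0%R) || (q x == 0%R) then 0%R
  else expR ((ln (q x) - ln (p x)) / 2).

Lemma measurable_log_ratio p q : measurable_fun [set: T] p ->
  measurable_fun [set: T] q -> measurable_fun [set: T] (log_ratio p q).
Proof.
move=> mp mq; rewrite /log_ratio.
apply: measurable_fun_ifT => //; first exact: measurable_fun_eqr.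
apply: measurable_fun_ifT => //; first exact: measurable_fun_eqr.
by apply/measurable_EFinP; apply: measurable_funB;
  apply: measurableT_comp => //; exact: measurable_ln.
Qed.

Lemma measurable_sqrt_ratio p q : measurable_fun [set: T] p ->
  measurable_fun [set: T] q -> measurable_fun [set: T] (sqrt_ratio p q).
Proof.
move=> mp mq; rewrite /sqrt_ratio.
apply: measurable_fun_ifT => //.
  by apply: measurable_or; exact: measurable_fun_eqr.
apply: measurableT_comp => //; apply: measurable_funM => //.
by apply: measurable_funB; apply: measurableT_comp => //; exact: measurable_ln.
Qed.

Lemma sqrt_ratio_ge0 p q x : (0 <= sqrt_ratio p q x)%R.
Proof. by rewrite /sqrt_ratio; case: ifP => // _; exact: expR_ge0. Qed.

Lemma sqrt_ratioM p q x : (0 <= p x)%R -> (0 <= q x)%R ->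
  (sqrt_ratio p q x * p x = Num.sqrt (p x * q x))%R.
Proof.
rewrite /sqrt_ratio le_eqVlt => /predU1P[<-|p0].
  by rewrite eqxx mulr0 mul0r sqrtr0.
rewrite (gt_eqF p0)/= le_eqVlt => /predU1P[<-|q0].
  by rewrite eqxx mul0r mulr0 sqrtr0.
rewrite (gt_eqF q0) -{2 3}(lnK p0) -{2}(lnK q0) -!expRD sqrt_expR.
by congr expR; lra.
Qed.

Lemma log_ratioM p q x : (0 <= p x)%R -> (0 <= q x)%R ->
  (p x)%:E * log_ratio p q x = (p x)%:E * lne ((p x)%:E / (q x)%:E).
Proof.
rewrite /log_ratio le_eqVlt => /predU1P[<-|p0]; first by rewrite !mul0e.
rewrite (gt_eqF p0) le_eqVlt => /predU1P[<-|q0].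
  by rewrite eqxx inve0 [in lne _]gt0_muley ?lte_fin.
rewrite (gt_eqF q0) inver (gt_eqF q0) -EFinM lne_EFin ?divr_gt0//.
by rewrite ln_div.
Qed.

Section RelativeEntropy.
Variables (P Q : probability T R) (p q : T -> R).
Hypotheses (dp : is_density mu P p) (dq : is_density mu Q q).

Let mp : measurable_fun [set: T] p. Proof. by case: dp. Qed.
Let mq : measurable_fun [set: T] q. Proof. by case: dq. Qed.
Let p_ge0 x : (0 <= p x)%R. Proof. by case: dp. Qed.
Let q_ge0 x : (0 <= q x)%R. Proof. by case: dq. Qed.
Let mlr := measurable_log_ratio mp mq.

Lemma integral_log_ratio : \int[P]_x log_ratio p q x = relative_entropy mu p q.
Proof.
rewrite integralE [RHS]integralE; congr (_ - _).
- rewrite (ge0_integral_density dp)//; last exact: measurable_funepos.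
  apply: eq_integral => x _.
  by rewrite !funeposE -log_ratioM// muleC maxe_pMr ?mule0// lee_fin.
- rewrite (ge0_integral_density dp)//; last exact: measurable_funeneg.
  apply: eq_integral => x _.
  by rewrite !funenegE -log_ratioM// muleC -muleN maxe_pMr ?mule0// lee_fin.
Qed.

(** From [p * ln (q / p) <= q - p].  Hence the relative entropy is never
    [-oo], and it is [+oo] unless [log_ratio] is integrable. *)
Lemma integral_log_ratio_funeneg_le1 : \int[P]_x (log_ratio p q)^\- x <= 1.
Proof.
rewrite (ge0_integral_density dp)//; last exact: measurable_funeneg.
rewrite -(integral_density_setT dq); apply: ge0_le_integral => //.
- by move=> x _; rewrite mule_ge0 ?lee_fin.
- apply: emeasurable_funM; first exact: measurable_funeneg.
  exact/measurable_EFinP.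
- exact/measurable_EFinP.
move=> x _; rewrite funenegE /log_ratio.
have := p_ge0 x; rewrite le_eqVlt => /predU1P[<-|p0].
  by rewrite mule0 lee_fin.
rewrite (gt_eqF p0); have := q_ge0 x; rewrite le_eqVlt => /predU1P[<-|q0].
  by rewrite eqxx /= max_r ?leNye// mul0e.
rewrite (gt_eqF q0) -EFinN -EFin_max -EFinM lee_fin opprB.
have [_|_] := leP (ln (q x) - ln (p x))%R 0%R; first by rewrite mul0r ltW.
rewrite -ln_div// -ler_pdivlMr//.
have := @le_ln1Dx R (q x / p x - 1); rewrite addrCA subrr addr0 => H.
have qp0 : (0 < q x / p x)%R by rewrite divr_gt0.
by have {}H := H ltac:(lra); lra.
Qed.

Lemma integrable_log_ratio : relative_entropy mu p q < +oo ->
  P.-integrable [set: T] (log_ratio p q).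
Proof.
rewrite -integral_log_ratio => fin; apply/integrableP; split => //.
rewrite (_ : \int[P]_x `|log_ratio p q x| =
    \int[P]_x ((log_ratio p q)^\+ x + (log_ratio p q)^\- x)); last first.
  apply: eq_integral => x _.
  by rewrite -[LHS]/((abse \o log_ratio p q) x) fune_abse.
have n1 := integral_log_ratio_funeneg_le1.
have nfin : \int[P]_x (log_ratio p q)^\- x \is a fin_num.
  rewrite ge0_fin_numE; first by apply: le_lt_trans n1 _; rewrite ltry.
  by apply: integral_ge0.
rewrite ge0_integralD//; [|exact: measurable_funepos|exact: measurable_funeneg].
rewrite integralE (lteBlDr _ _ nfin) in fin.
apply: lte_add_pinfty; last by rewrite ltey_eq nfin.
by apply: lt_le_trans fin _; rewrite leey.
Qed.

Lemma integral_sqrt_ratio :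
  \int[P]_x (sqrt_ratio p q x)%:E = affinity mu p q.
Proof.
rewrite (ge0_integral_density dp)//; last 2 first.
- by apply/measurable_EFinP; exact: measurable_sqrt_ratio.
- by move=> x; rewrite lee_fin sqrt_ratio_ge0.
by apply: eq_integral => x _; rewrite -EFinM sqrt_ratioM.
Qed.

End RelativeEntropy.

End Densities.

(** * The score of a parameter *)

Section IIDTransfer.
Context {R : realType} {dO dT : measure_display} {Omega : measurableType dO}.
Context {T : measurableType dT} {Pr : probability Omega R} {n : nat}.
Variables (P : probability T R) (X : 'I_n -> {RV Pr >-> T}).
Hypothesis X_iid : iid_sample P X.
Local Open Scope ereal_scope.

Lemma ge0_integral_iid (i : 'I_n) (f : T -> \bar R) :
  measurable_fun [set: T] f -> (forall x, 0 <= f x) ->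
  \int[Pr]_w f (X i w) = \int[P]_x f x.
Proof.
move=> mf f0; rewrite -[LHS](ge0_integral_distribution (X i) mf f0).
by apply: eq_measure_integral => A mA _; exact: (X_iid.2 i A mA).
Qed.

Lemma integral_iid (i : 'I_n) (f : T -> \bar R) :
  measurable_fun [set: T] f -> \int[Pr]_w f (X i w) = \int[P]_x f x.
Proof.
move=> mf; rewrite integralE [RHS]integralE; congr (_ - _).
- rewrite -(ge0_integral_iid i (f := f^\+))//; last exact: measurable_funepos.
  by apply: eq_integral => w _; rewrite !funeposE.
- rewrite -(ge0_integral_iid i (f := f^\-))//; last exact: measurable_funeneg.
  by apply: eq_integral => w _; rewrite !funenegE.
Qed.

Lemma integrable_iid (i : 'I_n) (f : T -> \bar R) :
  P.-integrable [set: T] f -> Pr.-integrable [set: Omega] (fun w => f (X i w)).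
Proof.
move=> /integrableP[mf fin]; apply/integrableP; split.
  exact: measurableT_comp.
rewrite (ge0_integral_iid i (f := fun x => `|f x|))//.
exact: measurableT_comp.
Qed.

End IIDTransfer.

Section Score.
Context {dT : measure_display} {T : measurableType dT} {R : realType}.
Context {n : nat}.
Variables (mu : {measure set T -> \bar R}) (p : T -> R).
Implicit Types (q : T -> R) (L : R) (x : 'I_n -> T).
Local Open Scope ereal_scope.

(** The inverse is taken in the extended reals: when the affinity is 0 the
    score is [+oo] at every sample where the product is positive, yet its mean
    is 0. *)
Definition score L q x : \bar R :=
  (expR (- (L / 2)))%:E *
  ((Num.sqrt (fine (affinity mu p q)) ^+ n)%R%:E)^-1 *
  (\prod_(i < n) sqrt_ratio p q (x i))%:E.

Lemma score_coef_ge0 L q :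
  0 <= (expR (- (L / 2)))%:E *
       ((Num.sqrt (fine (affinity mu p q)) ^+ n)%R%:E)^-1.
Proof.
by rewrite mule_ge0 ?inve_ge0 ?lee_fin ?expR_ge0 ?exprn_ge0 ?sqrtr_ge0.
Qed.

Lemma score_ge0 L q x : 0 <= score L q x.
Proof.
rewrite mule_ge0 ?score_coef_ge0// lee_fin.
by apply: prodr_ge0 => i _; exact: sqrt_ratio_ge0.
Qed.

(** With [E] the logarithm of the score of [q1], the identity
    [n D_B = 4 E + 2 L1 - 2 sum_i ln (q1 / p)] and the bound
    [E - ln C + 1 <= expR E / C] give the claim once the penalized likelihood
    of [q1] is replaced by that of [q0].  If [p] or [q0] vanishes at a data
    point the right-hand side is [+oo]; so it is if [q1] has affinity 0, since
    then the score of [q1] is [+oo]. *)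
Lemma bhattacharyya_le_score (q0 q1 : T -> R) (L0 L1 C : R) x (S : \bar R) :
  (0 < n)%N -> (0 < C)%R -> (forall t, 0 <= p t)%R -> (forall t, 0 <= q0 t)%R ->
  0 <= affinity mu p q1 <= 1 -> score L1 q1 x <= S ->
  \sum_(i < n) lne (q0 (x i))%:E - L0%:E <=
    \sum_(i < n) lne (q1 (x i))%:E - L1%:E ->
  n%:R%:E * bhattacharyya mu p q1 <=
    2%:E * (\sum_(i < n) log_ratio p q0 (x i)) +
    (2 * L0 + 4 * ln C - 4)%:E + (4 / C)%:E * S.
Proof.
move=> n_gt0 C0 p0 q00 /andP[A0 A1] scoreS lik.
have S0 : 0 <= S := le_trans (score_ge0 _ _ _) scoreS.
have CS0 : 0 <= (4 / C)%:E * S by rewrite mule_ge0// lee_fin divr_ge0// ltW.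
have lr_Ny i : log_ratio p q0 (x i) != -oo.
  by rewrite /log_ratio; do 2?case: ifP.
have sum_Ny : \sum_(i < n) log_ratio p q0 (x i) != -oo.
  by apply/eqP => /esum_eqNyP[i [_ _ E]]; move: (lr_Ny i); rewrite E eqxx.
have [[i Ei]|fin] := pselect (exists i, log_ratio p q0 (x i) = +oo).
  have -> : \sum_(i < n) log_ratio p q0 (x i) = +oo.
    apply/eqP; rewrite esum_eqy//; apply/existsP; exists i.
    by rewrite Ei eqxx.
  rewrite gt0_muley ?lte_fin// addye ?leey//.
  by apply/eqP => E; rewrite E in CS0.
have {}fin i : (0 < p (x i))%R /\ (0 < q0 (x i))%R.
  rewrite !lt_def p0 q00 !andbT.
  split; apply/negP => /eqP E; apply: fin; exists i.
    by rewrite /log_ratio E eqxx.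
  by rewrite /log_ratio E eqxx; case: ifP.
have pp i := (fin i).1; have qq i := (fin i).2.
have lik0 : \sum_(i < n) lne (q0 (x i))%:E = (\sum_(i < n) ln (q0 (x i)))%:E.
  by rewrite -sumEFin; apply: eq_bigr => i _; rewrite lne_EFin.
have q1p i : (0 < q1 (x i))%R.
  rewrite ltNge; apply/negP => q1i.
  have E : \sum_(i < n) lne (q1 (x i))%:E = -oo.
    apply/eqP; rewrite esum_eqNy; apply/existsP; exists i.
    by rewrite le0_lneNy// eqxx.
  by move: lik; rewrite lik0 E.
have lik1 : \sum_(i < n) lne (q1 (x i))%:E = (\sum_(i < n) ln (q1 (x i)))%:E.
  by rewrite -sumEFin; apply: eq_bigr => i _; rewrite lne_EFin.
move: lik; rewrite lik0 lik1 -!EFinB lee_fin => lik.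
have -> : \sum_(i < n) log_ratio p q0 (x i) =
    (\sum_(i < n) ln (p (x i)) - \sum_(i < n) ln (q0 (x i)))%:E.
  rewrite -sumrB -sumEFin; apply: eq_bigr => i _.
  by rewrite /log_ratio (gt_eqF (pp i)) (gt_eqF (qq i)).
have prodE : (\prod_(i < n) sqrt_ratio p q1 (x i) =
    expR ((\sum_(i < n) ln (q1 (x i)) - \sum_(i < n) ln (p (x i))) / 2))%R.
  rewrite -sumrB mulr_suml expR_sum; apply: eq_bigr => i _.
  by rewrite /sqrt_ratio (gt_eqF (pp i)) (gt_eqF (q1p i)).
move: scoreS; rewrite /score prodE /bhattacharyya.
move: A0 A1; case: (affinity mu p q1) => [al| |]//=.
rewrite lee_fin le_eqVlt => /predU1P[<- _|al0 _].
  rewrite /= sqrtr0 expr0n gtn_eqF//= inve0.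
  rewrite gt0_muley ?lte_fin ?expR_gt0// gt0_mulye ?lte_fin ?expR_gt0//.
  rewrite leye_eq => /eqP ->.
  by rewrite [(4 / C)%:E * +oo]gt0_muley ?lte_fin ?divr_gt0// leey.
set s := Num.sqrt al; have s0 : (0 < s)%R by rewrite sqrtr_gt0.
have alE : al = (s ^+ 2)%R by rewrite sqr_sqrtr ?ltW.
have snE : (s ^+ n = expR (n%:R * ln s))%R by rewrite expRM_natl lnK.
rewrite inver (gt_eqF (exprn_gt0 _ s0)) snE -expRN -EFinM -expRD -EFinM -expRD.
set Ex := (_ + _ + _)%R => scoreS.
rewrite inver (gt_eqF al0) lne_EFin ?invr_gt0// lnV// alE lnXn//.
have H : (4 / C * expR Ex)%:E <= (4 / C)%:E * S.
  by rewrite EFinM lee_wpmul2l// lee_fin divr_ge0// ltW.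
apply: le_trans (leeD2l _ H); rewrite -!EFinM -!EFinD lee_fin.
have : (Ex - ln C + 1 <= expR Ex / C)%R.
  rewrite -{2}(lnK C0) -expRB; apply: le_trans (expR_ge1Dx _); lra.
have -> : (4 / C * expR Ex = 4 * (expR Ex / C))%R by ring.
rewrite /Ex; lra.
Qed.

(** The mean of the product is the [n]-th power of the affinity; half of the
    exponent is cancelled by the coefficient. *)
Lemma integral_score (dO : measure_display) (Omega : measurableType dO)
    (Pr : probability Omega R) (X : 'I_n -> {RV Pr >-> T})
    (P Q : probability T R) q L : (0 < n)%N -> iid_sample P X ->
  is_density mu P p -> is_density mu Q q ->
  \int[Pr]_w score L q (fun i => X i w) =
    (expR (- (L / 2)) * Num.sqrt (fine (affinity mu p q)) ^+ n)%:E.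
Proof.
move=> n_gt0 X_iid dp dq; have [mp _ _] := dp; have [mq _ _] := dq.
have msr := measurable_sqrt_ratio mp mq.
have A0 := affinity_ge0 mu p q; have A1 := affinity_le1 dp dq.
have Afin : affinity mu p q \is a fin_num.
  by rewrite ge0_fin_numE//; apply: le_lt_trans A1 _; rewrite ltry.
have Ei i : \int[Pr]_w (sqrt_ratio p q (X i w))%:E = affinity mu p q.
  rewrite (ge0_integral_iid X_iid i (f := fun t : T => (sqrt_ratio p q t)%:E)).
  - exact: integral_sqrt_ratio dp dq.
  - exact/measurable_EFinP.
  - by move=> x; rewrite lee_fin sqrt_ratio_ge0.
rewrite /score ge0_integralZl//; last 3 first.
- apply/measurable_EFinP.
  by apply: measurable_prod => i _; apply: measurableT_comp.
- move=> w _; rewrite lee_fin.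
  by apply: prodr_ge0 => i _; exact: sqrt_ratio_ge0.
- exact: score_coef_ge0.
rewrite (indep_expectation_prod X_iid.1 (f := fun _ => sqrt_ratio p q))//;
  last 2 first.
- by move=> i x; exact: sqrt_ratio_ge0.
- by move=> i; rewrite Ei; apply: le_lt_trans A1 _; rewrite ltry.
under eq_bigr do rewrite Ei.
move: A0 Afin.
case: (affinity mu p q) => [al| |]//= al0 _; rewrite lee_fin in al0.
rewrite prodEFin prodr_const card_ord.
have -> : (al ^+ n = Num.sqrt al ^+ n * Num.sqrt al ^+ n)%R.
  by rewrite -exprMn -expr2 sqr_sqrtr.
set s := (Num.sqrt al ^+ n)%R.
rewrite inver; case: eqP => [->|/eqP s0]; first by rewrite !mulr0 mule0.
by rewrite -!EFinM; congr EFin; field.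
Qed.

End Score.

(** * Sums of scores and of their Gaussian envelopes *)

Section ScoreSum.
Context {R : realType}.

Lemma measurable_score (dT dO : measure_display) (T : measurableType dT)
    (Omega : measurableType dO) (n : nat) (mu : {measure set T -> \bar R})
    (Pr : probability Omega R) (X : 'I_n -> {RV Pr >-> T}) (p q : T -> R)
    (L : R) : measurable_fun [set: T] p -> measurable_fun [set: T] q ->
  measurable_fun [set: Omega] (fun w => score mu p L q (fun i => X i w)).
Proof.
move=> mp mq; apply: measurable_funeM; apply/measurable_EFinP.
apply: measurable_prod => i _; apply: measurableT_comp => //.
exact: measurable_sqrt_ratio.
Qed.

Lemma nneseries_le_fin (u : nat -> \bar R) (B : \bar R) :
  (forall k, 0 <= u k)%E -> (forall m, \sum_(0 <= k < m) u k <= B)%E ->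
  (\sum_(k <oo) u k <= B)%E.
Proof.
move=> u0 uB; apply: lime_le; first exact: is_cvg_nneseries.
exact: nearW.
Qed.

Lemma le_nneseries_term (u : nat -> \bar R) (k : nat) :
  (forall k, 0 <= u k)%E -> (u k <= \sum_(k <oo) u k)%E.
Proof.
move=> u0; apply: (@le_trans _ _ (\sum_(0 <= j < k.+1) u j)%E).
  by rewrite big_nat_recr//= leeDr// sume_ge0.
by apply: nneseries_lim_ge => j _ _.
Qed.

(** [pickle_inv] enumerates [J] without repetition, so that a bound on finite
    sums over [J] is one on the partial sums of a series indexed by [nat]. *)
Lemma sum_pickle_inv_le (J : countType) (G : J -> R) (B : R) :
  (forall s : seq J, uniq s -> \sum_(j <- s) G j <= B) ->
  forall m, \sum_(0 <= k < m) oapp G 0 (@pickle_inv J k) <= B.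
Proof.
move=> GB m; pose s := pmap (@pickle_inv J) (index_iota 0 m).
have us : uniq s by apply: (pmap_uniq (@pickle_invK J)); exact: iota_uniq.
by have := GB s us; rewrite /s big_pmap.
Qed.

End ScoreSum.

Section LatticeWeights.
Context {R : realType} {d : nat}.
Variables (eps m b c r : R) (v theta_s theta_t : 'rV[R]_d).
Hypotheses (eps_gt0 : 0 < eps) (m_gt0 : 0 < m) (b_gt0 : 0 < b) (c_gt0 : 0 < c).
Hypothesis r_ge0 : 0 <= r.

Definition weight_bound : R :=
  2 * (1 + 2 * Num.sqrt (2 * pi) / (eps * Num.sqrt (m * c))) ^+ d
    * (1 + (29 * Num.sqrt d%:R + 6 * r) / (eps * Num.sqrt (m * b))) ^+ d
    * expR (enorm theta_s ^+ 2 / 2).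

(** First term: the bound inside the ball, where the affinity decays like a
    Gaussian.  Second term: the bound outside, where the decay comes from the
    penalty recentred at [theta_s] and [expR (- (m * b / 2))] from the
    affinity. *)
Definition envelope (theta : 'rV[R]_d) : R :=
  expR (- (m * c / 2 * enorm (theta - theta_t) ^+ 2)) +
  expR (enorm theta_s ^+ 2 / 2) * expR (- (m * b / 2))
    * expR (- (4^-1 * enorm (theta - theta_s) ^+ 2)).

Lemma envelope_ge0 theta : 0 <= envelope theta.
Proof. by rewrite addr_ge0 ?mulr_ge0 ?expR_ge0. Qed.

Let fin_ge1 : 1 <= 1 + 2 * Num.sqrt (2 * pi) / (eps * Num.sqrt (m * c)).
Proof.
by rewrite lerDl divr_ge0 ?mulr_ge0 ?sqrtr_ge0// ltW.
Qed.

Let fout_ge1 :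
  1 <= 1 + (29 * Num.sqrt d%:R + 6 * r) / (eps * Num.sqrt (m * b)).
Proof.
by rewrite lerDl divr_ge0 ?addr_ge0 ?mulr_ge0 ?sqrtr_ge0// ltW.
Qed.

(** The two Gaussian sums are each at most one of the two powers in
    [weight_bound]; since all factors are at least 1 the sum is at most twice
    their product. *)
Lemma sum_envelope_le (s : seq 'rV[int]_d) : uniq s ->
  \sum_(z <- s) envelope (v + eps *: map_mx intr z) <= weight_bound.
Proof.
move=> us; rewrite big_split/= -mulr_sumr.
have mc0 : 0 < m * c / 2 by rewrite divr_gt0// mulr_gt0.
have Hin := sum_lattice_gaussian_le v theta_t mc0 eps_gt0 us.
have q0 : 0 < 4^-1 :> R by [].
have Hout := sum_lattice_gaussian_le v theta_s q0 eps_gt0 us.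
have pi0 := pi_ge0 R.
have {}Hin : \sum_(z <- s) expR (- (m * c / 2 *
    enorm (v + eps *: map_mx intr z - theta_t) ^+ 2)) <=
    (1 + 2 * Num.sqrt (2 * pi) / (eps * Num.sqrt (m * c))) ^+ d.
  apply: le_trans Hin _; apply: lerXn2r; rewrite ?nnegrE.
  - by rewrite addr_ge0// divr_ge0// mulr_ge0 ?sqrtr_ge0// ltW.
  - by apply: le_trans fin_ge1.
  - exact: gaussian_factor_in_le.
have {}Hout : expR (- (m * b / 2)) * \sum_(z <- s) expR (- (4^-1 *
    enorm (v + eps *: map_mx intr z - theta_s) ^+ 2)) <=
    (1 + (29 * Num.sqrt d%:R + 6 * r) / (eps * Num.sqrt (m * b))) ^+ d.
  apply: le_trans (gaussian_factor_out_le d eps_gt0 m_gt0 b_gt0 r_ge0).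
  by rewrite ler_wpM2l ?expR_ge0.
rewrite /weight_bound.
set A := (_ ^+ d) in Hin *; set B := (_ ^+ d) in Hout *.
set E := expR (enorm theta_s ^+ 2 / 2).
have A1 : 1 <= A by rewrite exprn_ege1.
have B1 : 1 <= B by rewrite exprn_ege1.
have E1 : 1 <= E by rewrite /E -[leLHS]expR0 ler_expR divr_ge0 ?sqr_ge0.
have AB : A <= A * B * E.
  by rewrite -mulrA ler_peMr ?(le_trans ler01)// mulr_ege1.
have EB : E * B <= A * B * E.
  rewrite mulrC -[leLHS]mul1r -mulrA ler_wpM2r// mulr_ge0//.
    exact: le_trans B1.
  exact: le_trans E1.
have {}Hout := ler_wpM2l (le_trans ler01 E1) Hout.
by lra.
Qed.

Lemma ln_weight_bound : ln weight_bound =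
  ln 2 + d%:R * (ln (1 + 2 * Num.sqrt (2 * pi) / (eps * Num.sqrt (m * c)))
    + ln (1 + (29 * Num.sqrt d%:R + 6 * r) / (eps * Num.sqrt (m * b))))
  + enorm theta_s ^+ 2 / 2.
Proof.
have A0 := lt_le_trans ltr01 fin_ge1; have B0 := lt_le_trans ltr01 fout_ge1.
rewrite /weight_bound !lnM ?posrE ?mulr_gt0 ?expR_gt0 ?exprn_gt0//.
by rewrite !lnXn// expRK (mulr_natl _ d) mulrnDl !addrA.
Qed.

Lemma weight_bound_gt0 : 0 < weight_bound.
Proof.
have A0 := lt_le_trans ltr01 fin_ge1; have B0 := lt_le_trans ltr01 fout_ge1.
by rewrite !mulr_gt0 ?exprn_gt0 ?expR_gt0.
Qed.

End LatticeWeights.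

Lemma weight_le_envelope (R : realType) (d n : nat) (a b c r al : R)
    (theta theta_s theta_t : 'rV[R]_d) : 0 < a -> 0 < b ->
  11 * a `^ b^-1 <= r ->
  (~ closed_eball theta_s r theta -> al <= a / enorm (theta - theta_s) `^ b) ->
  (closed_eball theta_s r theta ->
     al <= expR (- (c * enorm (theta - theta_t) ^+ 2))) ->
  expR (- (enorm theta ^+ 2 / 2)) * Num.sqrt al ^+ n
    <= envelope n%:R b c theta_s theta_t theta.
Proof.
move=> a0 b0 ar Aout Ain; rewrite /envelope.
have [Bin|Bout] := pselect (closed_eball theta_s r theta).
  apply: (@le_trans _ _ (1 * Num.sqrt al ^+ n)).
    rewrite ler_wpM2r ?exprn_ge0 ?sqrtr_ge0// expR_le1 oppr_le0.
    by rewrite divr_ge0 ?sqr_ge0.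
  rewrite mul1r; apply: le_trans (sqrt_exprn_le_expR n (Ain Bin)) _.
  rewrite (_ : n%:R * (c * enorm (theta - theta_t) ^+ 2) / 2 =
    n%:R * c / 2 * enorm (theta - theta_t) ^+ 2); last by ring.
  by rewrite lerDl !mulr_ge0 ?expR_ge0.
have rx : r < enorm (theta - theta_s) by rewrite ltNge; apply/negP.
have h := le_trans (Aout Bout) (affinity_tail_le a0 b0 ar rx).
apply: le_trans (ler_wpDl (expR_ge0 _) (lexx _)).
rewrite [leRHS]mulrAC; apply: ler_pM; rewrite ?expR_ge0 ?exprn_ge0 ?sqrtr_ge0//.
  exact: penalty_shift_le.
exact: sqrt_exprn_le_expR.
Qed.

(** * Risk of the penalized MLE *)

(** The risk bound for an arbitrary penalty and a countable parameter set;
    [sumC] bounds the sum of the mean scores. *)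
Lemma penalized_mle_risk_le (R : realType)
  (dT : measure_display) (T : measurableType dT)
  (mu : {measure set T -> \bar R})
  (dO : measure_display) (Omega : measurableType dO)
  (Pr : probability Omega R)
  (d n : nat) (n_gt0 : (0 < n)%N)
  (P : probability T R) (p : T -> R) (dp : is_density mu P p)
  (Theta : set 'rV[R]_d)
  (Q : 'rV[R]_d -> probability T R) (q : 'rV[R]_d -> T -> R)
  (dq : forall theta, Theta theta -> is_density mu (Q theta) (q theta))
  (pen : 'rV[R]_d -> R)
  (X : 'I_n -> {RV Pr >-> T}) (X_iid : iid_sample P X)
  (est : ('I_n -> T) -> 'rV[R]_d) (estP : is_penalized_mle q pen Theta est)
  (J : countType) (param : J -> 'rV[R]_d)
  (param_surj : forall theta, Theta theta -> exists j, param j = theta)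
  (C : R) (C_gt0 : 0 < C)
  (sumC : forall s : seq J, uniq s ->
     \sum_(j <- s) (if `[< Theta (param j) >] then
        expR (- (pen (param j) / 2)) *
        Num.sqrt (fine (affinity mu p (q (param j)))) ^+ n else 0) <= C)
  (theta : 'rV[R]_d) (theta_in : Theta theta) :
  (\int[Pr]_w bhattacharyya mu p (q (est (fun i => X i w)))
   <= 2%:E * (relative_entropy mu p (q theta) + (pen theta / n%:R)%:E)
      + (4 * ln C / n%:R)%:E)%E.
Proof.
have n0 : 0 < n%:R :> R by rewrite ltr0n.
have [mp p_ge0 _] := dp; have [mq q_ge0 _] := dq _ theta_in.
have entropy_ge : (-1 <= relative_entropy mu p (q theta))%E.
  rewrite -(integral_log_ratio dp (dq _ theta_in)) integralE.
  have := integral_log_ratio_funeneg_le1 dp (dq _ theta_in).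
  move=> h; apply: (@le_trans _ _ (0 - 1)%E); first by rewrite sub0e.
  apply: leeB => //; apply: integral_ge0 => x _; exact: funepos_ge0.
have [fin|] := ltP (relative_entropy mu p (q theta)) +oo%E; last first.
  rewrite leye_eq => /eqP ->.
  by rewrite addye// gt0_muley ?lte_fin// addye// leey.
(* The guard confines the sum to parameters for which [q] is a density. *)
pose f j w : \bar R := if `[< Theta (param j) >] then
  score mu p (pen (param j)) (q (param j)) (fun i => X i w) else 0%E.
pose s k w : \bar R := oapp (f^~ w) 0%E (@pickle_inv J k).
have f_ge0 j w : (0 <= f j w)%E.
  by rewrite /f; case: ifP => // _; exact: score_ge0.
have s_ge0 k w : (0 <= s k w)%E by rewrite /s; case: pickle_inv => //=.
have mf j : measurable_fun [set: Omega] (f j).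
  rewrite /f; case: asboolP => // Tj.
  by apply: measurable_score => //; have [] := dq _ Tj.
have ms k : measurable_fun [set: Omega] (s k).
  by rewrite /s; case: pickle_inv => //=.
pose S w : \bar R := (\sum_(k <oo) s k w)%E.
have mS : measurable_fun [set: Omega] S.
  by apply: ge0_emeasurable_sum => // k x _ _; exact: s_ge0.
have S_ge0 w : (0 <= S w)%E by apply: nneseries_ge0.
have intS : (\int[Pr]_w S w <= C%:E)%E.
  rewrite integral_nneseries//.
  apply: nneseries_le_fin => [k|m]; first exact: integral_ge0.
  apply: (@le_trans _ _ (\sum_(0 <= k < m) oapp (fun j =>
      if `[< Theta (param j) >] then
        expR (- (pen (param j) / 2)) *
        Num.sqrt (fine (affinity mu p (q (param j)))) ^+ n else 0) 0
        (@pickle_inv J k))%:E); last first.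
    by rewrite lee_fin; exact: sum_pickle_inv_le.
  rewrite -sumEFin; apply: lee_sum => k _; rewrite /s.
  case: pickle_inv => [j|] /=; last by rewrite integral0.
  rewrite /f; case: asboolP => Tj; last by rewrite integral0.
  by rewrite (integral_score _ _ X_iid dp (dq _ Tj)).
(* The MLE is one of the parameters over which [S] sums. *)
have scoreS w : (score mu p (pen (est (fun i => X i w)))
    (q (est (fun i => X i w))) (fun i => X i w) <= S w)%E.
  have [Te _] := estP (fun i => X i w).
  have [j jE] := param_surj _ Te.
  have -> : score mu p (pen (est (fun i => X i w)))
      (q (est (fun i => X i w))) (fun i => X i w) = s (pickle j) w.
    by rewrite /s pickleK_inv/= /f jE asboolT.
  exact: (le_nneseries_term (u := s^~ w)).
pose lr i w := log_ratio p (q theta) (X i w).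
pose U w := (2%:E * \sum_(i < n) lr i w)%E.
pose K := 2 * pen theta + 4 * ln C - 4.
have intlr i : Pr.-integrable [set: Omega] (lr i).
  apply: (integrable_iid X_iid).
  exact: integrable_log_ratio dp (dq _ theta_in) fin.
have intsum : Pr.-integrable [set: Omega] (fun w => \sum_(i < n) lr i w)%E.
  by apply: integrable_sum => //.
have intU : Pr.-integrable [set: Omega] U by apply: integrableZl.
have intK : Pr.-integrable [set: Omega] (cst K%:E).
  exact: finite_measure_integrable_cst.
have iS : Pr.-integrable [set: Omega] S.
  apply/integrableP; split => //; under eq_integral do rewrite gee0_abs//.
  by apply: le_lt_trans intS _; rewrite ltry.
have iV : Pr.-integrable [set: Omega] (fun w => (4 / C)%:E * S w)%E.
  exact: integrableZl.
pose g w := (n%:R^-1%:E * (U w + K%:E + (4 / C)%:E * S w))%E.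
apply: (@le_trans _ _ (\int[Pr]_w g w)%E).
  apply: ge0_le_lower_integral => w.
    have [Te _] := estP (fun i => X i w).
    exact: bhattacharyya_ge0 dp (dq _ Te).
  have [Te mle] := estP (fun i => X i w).
  rewrite -[leLHS]mul1e -(mulVf (lt0r_neq0 n0)) EFinM -muleA /g.
  rewrite lee_wpmul2l ?lee_fin ?invr_ge0 ?(ltW n0)//.
  apply: (bhattacharyya_le_score n_gt0 C_gt0 p_ge0 q_ge0 _ (scoreS w)).
    by rewrite affinity_ge0 (affinity_le1 dp (dq _ Te)).
  exact: mle theta_in.
rewrite /g integralZl//; last by apply: integrableD => //; apply: integrableD.
rewrite integralD//; last by apply: integrableD.
rewrite integralD//.
have -> : (\int[Pr]__ K%:E = K%:E)%E.
  rewrite -[LHS]/(\int[Pr]_x cst K%:E x)%E integral_cst//.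
  by rewrite [X in (_ * X)%E]probability_setT mule1.
rewrite integralZl// integral_sum//.
under eq_bigr => i _ do
  rewrite (integral_iid X_iid i (measurable_log_ratio mp mq))
    (integral_log_ratio dp (dq _ theta_in)).
have Dfin : relative_entropy mu p (q theta) \is a fin_num.
  rewrite fin_numElt fin andbT; apply: lt_le_trans entropy_ge; exact: ltNyr.
rewrite -(fineK Dfin) sumEFin sumr_const card_ord -[fine _ *+ n]mulr_natl.
rewrite integralZl//.
apply: (@le_trans _ _ (n%:R^-1%:E *
    (2%:E * (n%:R * fine (relative_entropy mu p (q theta)))%:E + K%:E
     + (4 / C)%:E * C%:E))%E).
  rewrite lee_wpmul2l ?lee_fin ?invr_ge0 ?(ltW n0)//.
  by rewrite leeD2l// lee_wpmul2l// lee_fin divr_ge0// ltW.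
rewrite -!EFinM -!EFinD lee_fin le_eqVlt; apply/orP; left; apply/eqP.
by rewrite /K; field; rewrite !gt_eqF.
Qed.

(** * The quadratic penalty *)

Theorem mainTheorem3 (R : realType)
  (dT : measure_display) (T : measurableType dT)
  (mu : {measure set T -> \bar R})
  (dO : measure_display) (Omega : measurableType dO)
  (Pr : probability Omega R)
  (d n : nat) (n_gt0 : (0 < n)%N)
  (P : probability T R) (p : T -> R) (p_density : is_density mu P p)
  (Theta : set 'rV[R]_d)
  (Pmodel : 'rV[R]_d -> probability T R) (pmodel : 'rV[R]_d -> T -> R)
  (pmodel_density : forall theta, Theta theta ->
     is_density mu (Pmodel theta) (pmodel theta))
  (eps : R) (eps_gt0 : 0 < eps)
  (Theta_eps : set 'rV[R]_d)
  (Theta_epsP : is_discretization eps Theta Theta_eps)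
  (X : 'I_n -> {RV Pr >-> T}) (X_iid : iid_sample P X)
  (thetahat : ('I_n -> T) -> 'rV[R]_d)
  (thetahatP : is_penalized_mle pmodel (fun theta => enorm theta ^+ 2)
     Theta_eps thetahat)
  (theta_s theta_t : 'rV[R]_d)
  (theta_s_in : Theta theta_s) (theta_t_in : Theta theta_t)
  (radius a b c : R) (a_gt0 : 0 < a) (b_gt0 : 0 < b) (c_gt0 : 0 < c)
  (affinity_out : forall theta, Theta theta ->
     ~ closed_eball theta_s radius theta ->
     (affinity mu p (pmodel theta)
        <= (a / enorm (theta - theta_s) `^ b)%:E)%E)
  (affinity_in : forall theta, Theta theta ->
     closed_eball theta_s radius theta ->
     (affinity mu p (pmodel theta)
        <= (expR (- (c * enorm (theta - theta_t) ^+ 2)))%:E)%E)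
  (radius_ge : Num.max (11 * a `^ b^-1) (3 * eps) <= radius) :
  (\int[Pr]_w bhattacharyya mu p (pmodel (thetahat (fun i => X i w)))
   <= 2%:E * resolvability pmodel n mu p
               (fun theta => enorm theta ^+ 2)%R Theta_eps
      + (4 * d%:R
           * (ln (1 + 2 * Num.sqrt (2 * pi)
                        / (eps * Num.sqrt (n%:R * c)))
              + ln (1 + (29 * Num.sqrt d%:R + 6 * radius)
                        / (eps * Num.sqrt (n%:R * b))))
         / n%:R)%:E
      + ((4 * ln (2 + 2 * (22 / radius ^+ 3))
          + 2 * enorm theta_s ^+ 2 + 8)
         / n%:R)%:E)%E.
Proof.
have powr_le : 11 * a `^ b^-1 <= radius.
  by move: radius_ge; rewrite ge_max => /andP[].
have r_gt0 : 0 < radius.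
  by apply: lt_le_trans powr_le; rewrite mulr_gt0// powR_gt0.
have n0 : 0 < n%:R :> R by rewrite ltr0n.
have [v TE] := Theta_epsP.
have sub theta : Theta_eps theta -> Theta theta by rewrite TE => -[].
pose param (z : 'rV[int]_d) := v + eps *: map_mx intr z.
pose C := weight_bound eps n%:R b c radius theta_s.
have C_gt0 : 0 < C by apply: weight_bound_gt0 => //; exact: ltW.
have affE theta : Theta theta ->
    affinity mu p (pmodel theta) = (fine (affinity mu p (pmodel theta)))%:E.
  move=> Tt; rewrite fineK// ge0_fin_numE ?affinity_ge0//.
  apply: le_lt_trans (affinity_le1 p_density (pmodel_density _ Tt)) _.
  by rewrite ltry.
have sumC (s : seq 'rV[int]_d) : uniq s ->
    \sum_(z <- s) (if `[< Theta_eps (param z) >] then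
      expR (- (enorm (param z) ^+ 2 / 2)) *
      Num.sqrt (fine (affinity mu p (pmodel (param z)))) ^+ n else 0) <= C.
  move=> us; apply: le_trans
    (sum_envelope_le v theta_s theta_t eps_gt0 n0 b_gt0 c_gt0 (ltW r_gt0) us).
  apply: ler_sum => z _; case: asboolP => [/sub Tz|_]; last exact: envelope_ge0.
  apply: (weight_le_envelope n a_gt0 b_gt0 powr_le) => Bz.
    by rewrite -lee_fin -affE//; exact: affinity_out.
  by rewrite -lee_fin -affE//; exact: affinity_in.
pose K : R := 4 * ln C / n%:R.
set LHS := (\int[Pr]_w _)%E.
have bound theta : Theta_eps theta -> (LHS <= 2%:E *
    (relative_entropy mu p (pmodel theta) + (enorm theta ^+ 2 / n%:R)%:E)
    + K%:E)%E.
  move=> Tt; apply: (penalized_mle_risk_le n_gt0 p_density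
    (fun theta Tt => pmodel_density theta (sub theta Tt)) X_iid thetahatP
    (param := param) _ C_gt0 sumC Tt).
  by move=> th; rewrite TE => -[_ [z _ <-]]; exists z.
have {}bound : (LHS <= 2%:E * resolvability pmodel n mu p
    (fun theta => enorm theta ^+ 2)%R Theta_eps + K%:E)%E.
  rewrite -leeBlDr// -lee_pdivrMl//; apply: le_ereal_inf_tmp => _ [theta Tt <-].
  by rewrite lee_pdivrMl// leeBlDr//; exact: bound.
apply: le_trans bound _; rewrite -addeA leeD2l// -EFinD lee_fin -mulrDl.
rewrite ler_pM2r ?invr_gt0// /C ln_weight_bound//; last exact: ltW.
(* The factor 2 in [weight_bound] is absorbed by the term in [radius ^+ 3]. *)
have ln2 : ln 2 <= ln (2 + 2 * (22 / radius ^+ 3)) :> R.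
  have h : 0 <= 2 * (22 / radius ^+ 3).
    by rewrite mulr_ge0// divr_ge0// exprn_ge0// ltW.
  by rewrite ler_ln ?posrE ?lerDl// ltr_wpDr.
by lra.
Qed.
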